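(* Let $K$ be an infinite integral domain and $G=\mathbb{Z}_3$. The weak $T_G$-ideal $J$ of $K\langle X\rangle$ generated by all identities of type 1 and all identities of type 2 is generated, as a weak $T_G$-ideal, by the reduced identities of type 1 together with the reduced identities of type 2.
   Context: $G=\mathbb{Z}_3$ is written additively in its own operation, with neutral element $\overline{0}$. Free algebra: $\{X_g \mid g\in G\}$ is a family of disjoint countably infinite sets, $X=\bigcup_{g\in G}X_g$, and $K\langle X\rangle$ is the free associative unital $K$-algebra on $X$. For $x\in X_g$ put $\alpha(x)=g$; for a monomial $m=x_{i_1}\cdots x_{i_l}$, $\alpha(m)$ is the sum in $\mathbb{Z}_3$ of $\alpha(x_{i_1}),\ldots,\alpha(x_{i_l})$, and $\alpha(1)=\overline{0}$, where $1$ is the unity of $K\langle X\rangle$. $K\langle X\rangle$ is $G$-graded with $K\langle X\rangle_g$ the $K$-span of the monomials $m$ with $\alpha(m)=g$. $L$ is the Lie subalgebra of $K\langle X\rangle^{(-)}$ (product $[a,b]=ab-ba$) generated by $X$. Weak $T_G$-ideal: an ideal $I$ of $K\langle X\rangle$ such that $\phi(I)\subset I$ for every graded endomorphism $\phi$ of $K\langle X\rangle$ with $\phi(x)\in L\cap K\langle X\rangle_{\alpha(x)}$ for all $x\in X$. The weak $T_G$-ideal generated by a set $S$ is the intersection of all weak $T_G$-ideals containing $S$. Identities of type 1: the polynomials $[h_1,h_2]$ where $h_1,h_2$ are monomials, $\alpha(h_1)=\alpha(h_2)=\overline{0}$, and $h_1h_2$ is multilinear. Such an identity is reduced when $h_1$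 and $h_2$ are monomials of degree at most $3$. Identities of type 2: the polynomials $h_1h_2h_3-h_3h_2h_1$ where $h_1,h_2,h_3$ are monomials, $\alpha(h_1)=\alpha(h_3)=-\alpha(h_2)$, and $h_1h_2h_3$ is multilinear. Such an identity is reduced when $h_1,h_2,h_3$ are monomials of degree at most $3$. *)

(* Defs.v *)
From HB Require Import structures.
From mathcomp Require Import all_boot all_order all_algebra.
From mathcomp Require Import classical_sets cardinality.
From mathcomp Require Import monalg.

Set Implicit Arguments.
Unset Strict Implicit.
Unset Printing Implicit Defensive.

Import GRing.Theory.

Local Open Scope ring_scope.
Local Open Scope classical_set_scope.

(* The variable (g, n) is the n-th element of X_g. *)
Definition var : choiceType := ('Z_3 * nat)%type.

(* Words on var; the empty word is the monomial 1. *)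
Notation mono := {fmonom var}.

(* The monoid algebra of the free monoid on var, i.e. the free associative
   unital algebra; the monomial m is << m >> and the variable x is << fmu x >>. *)
Notation freealg K := {malg K[mono]}.

Definition alpha (m : mono) : 'Z_3 := \sum_(x <- m) x.1.

Section GradedIdentities.
Variable K : idomainType.
Implicit Types (f : freealg K) (h m : mono) (g : 'Z_3).

Definition homog g : set (freealg K) :=
  [set f | exists (s : seq mono) (c : mono -> K),
     (forall m, m \in s -> alpha m = g) /\ f = \sum_(m <- s) c m *: << m >>].

Definition bracket (a b : freealg K) : freealg K := a * b - b * a.

Definition lie_subalgebra (S : set (freealg K)) : Prop :=
  [/\ S 0,
      forall (c : K) a b, S a -> S b -> S (c *: a + b)
    & forall a b, S a -> S b -> S (bracket a b)].

Definition lieL : set (freealg K) :=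
  smallest lie_subalgebra [set << fmu x >> | x in [set: var]].

Definition ideal (I : set (freealg K)) : Prop :=
  [/\ I 0,
      forall a b, I a -> I b -> I (a - b)
    & forall a b f, I f -> I (a * f * b)].

Definition graded_endo (phi : {lrmorphism freealg K -> freealg K}) : Prop :=
  forall g, phi @` homog g `<=` homog g.

Definition weak_TG_ideal (I : set (freealg K)) : Prop :=
  ideal I /\
  forall phi : {lrmorphism freealg K -> freealg K},
    graded_endo phi ->
    (forall x : var, (lieL `&` homog x.1) (phi << fmu x >>)) ->
    phi @` I `<=` I.

Definition weak_TG_ideal_gen (S : set (freealg K)) : set (freealg K) :=
  smallest weak_TG_ideal S.

(* A monomial is multilinear when no variable is repeated in it. *)
Definition multilinear m : bool := uniq m.

Definition type1_cond h1 h2 : Prop :=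
  [/\ alpha h1 = 0, alpha h2 = 0 & multilinear (mmul h1 h2)].

Definition type1 : set (freealg K) :=
  [set f | exists h1 h2, type1_cond h1 h2 /\ f = bracket << h1 >> << h2 >>].

Definition reduced_type1 : set (freealg K) :=
  [set f | exists h1 h2,
     [/\ type1_cond h1 h2, (fdeg h1 <= 3)%N, (fdeg h2 <= 3)%N
       & f = bracket << h1 >> << h2 >>]].

Definition type2_cond h1 h2 h3 : Prop :=
  [/\ alpha h1 = alpha h3, alpha h3 = - alpha h2
    & multilinear (mmul (mmul h1 h2) h3)].

Definition type2_poly h1 h2 h3 : freealg K :=
  << h1 >> * << h2 >> * << h3 >> - << h3 >> * << h2 >> * << h1 >>.

Definition type2 : set (freealg K) :=
  [set f | exists h1 h2 h3, type2_cond h1 h2 h3 /\ f = type2_poly h1 h2 h3].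

Definition reduced_type2 : set (freealg K) :=
  [set f | exists h1 h2 h3,
     [/\ type2_cond h1 h2 h3,
         [/\ (fdeg h1 <= 3)%N, (fdeg h2 <= 3)%N & (fdeg h3 <= 3)%N]
       & f = type2_poly h1 h2 h3]].

End GradedIdentities.

Arguments lieL K : clear implicits.
Arguments type1 K : clear implicits.
Arguments reduced_type1 K : clear implicits.
Arguments type2 K : clear implicits.
Arguments reduced_type2 K : clear implicits.

(* Main.v *)
(* Modulo shorter words, the letters of a product of homogeneous Lie elements
   commute, because a bracket of two letters is again a homogeneous Lie element.
   Any three elements of Z_3 have a nonempty subfamily of sum zero, so the
   component of degree g is spanned by products of words of length at most 3
   and degree 0 with one word of length at most 3 and degree g. Identities in
   words of length at most 3 are instances of the reduced ones, and the general
   identities follow because the degree 0 words commute with each other modulo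
   the reduced identities of type 1. *)

From HB Require Import structures.
Require Import Defs.
From mathcomp Require Import all_boot all_order all_algebra.
From mathcomp Require Import classical_sets cardinality.
From mathcomp Require Import finmap monalg.

Set Implicit Arguments.
Unset Strict Implicit.
Unset Printing Implicit Defensive.

Import GRing.Theory.

Local Open Scope ring_scope.
Local Open Scope classical_set_scope.

(** Two nonzero elements of $\mathbb{Z}_3$ with nonzero sum are equal. So if the first five sums are
    nonzero then $a = b = c$, and $a + b + c = 3a = 0$. *)
Lemma Z3_zero_subsum (a b c : 'Z_3) :
  [|| a == 0, b == 0, c == 0, a + b == 0, b + c == 0 | a + b + c == 0].
Proof.
by move: a b c; do 3![case=> [[|[|[|?]]] ?] //].
Qed.

Lemma alphaM m1 m2 : alpha (mmul m1 m2) = alpha m1 + alpha m2.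
Proof. by rewrite /alpha fmM big_cat. Qed.

Lemma alpha1 : alpha mone = 0.
Proof. by rewrite /alpha fm1 big_nil. Qed.

Lemma alphaU (x : var) : alpha (fmu x) = x.1.
Proof. by rewrite /alpha fmU big_seq1. Qed.

(** * Ring identities for the type 2 expression *)

Section Swap13.
Variable R : pzRingType.
Implicit Types a b c d : R.

(** The shape of [type2_poly], with arbitrary ring elements for the monomials. *)
Definition swap13 a b c := a * b * c - c * b * a.

Lemma swap13Dl a b c d : swap13 (a + b) c d = swap13 a c d + swap13 b c d.
Proof. by rewrite /swap13 !mulrDl mulrDr opprD addrACA. Qed.

Lemma swap13Dm a b c d : swap13 c (a + b) d = swap13 c a d + swap13 c b d.
Proof. by rewrite /swap13 !mulrDr !mulrDl opprD addrACA. Qed.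

(** Splits off a left factor [a] at the cost of its commutator with [d * c], which has degree 0 when
    [d] and [c] have opposite degrees. *)
Lemma swap13Ml a b c d :
  swap13 (a * b) c d = a * swap13 b c d + (a * (d * c) - d * c * a) * b.
Proof. by rewrite /swap13 mulrBl mulrBr !mulrA addrA subrK. Qed.

(** Here the right factor [a] of the middle term is split off; the error terms are its commutators
    with [c * b] and [d * b]. *)
Lemma swap13Mm a b c d : swap13 c (b * a) d =
  (c * b * a - a * (c * b)) * d + a * swap13 c b d
  - (d * b * a - a * (d * b)) * c.
Proof.
by rewrite /swap13 !mulrBl mulrBr !mulrA addrA subrK opprB addrA subrK.
Qed.

End Swap13.

(** * Homogeneous elements and homogeneous Lie elements *)

Section GradedWords.
Variable K : idomainType.
Implicit Types (a b c : freealg K) (g : 'Z_3) (p q : 'Z_3 * freealg K).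
Implicit Types (w s z : seq ('Z_3 * freealg K)).

(** Trades the choice of a presentation for a condition on the support, from which the closure
    properties are read off; conversely, the support itself is a presentation. *)
Lemma homogP g a : homog g a <-> forall m, a@_m != 0 -> alpha m = g.
Proof.
split=> [[s [c [sg ->]]] m|ag].
  rewrite raddf_sum /= => nz.
  have /hasP[m' m's /eqP] : has (fun m' => (c m' *: << m' >>)@_m != 0) s.
    apply: contraNT nz => /hasPn s0; rewrite big_seq big1 // => m' /s0.
    by rewrite negbK => /eqP.
  rewrite mcoeffZ mcoeffU1; case: (altP (m' =P m)) => [<- _|]; first exact: sg.
  by rewrite mulr0.
exists (enum_fset (msupp a)), (fun m => a@_m); split=> [m|].
  by rewrite -mcoeff_neq0; apply: ag.
rewrite [LHS]monalgE; apply: eq_bigr => m _.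
apply/malgP => k; rewrite mcoeffZ !mcoeffU.
by case: eqP => _; rewrite ?mulr1 // !mulr0n mulr0.
Qed.

Lemma homog0 g : homog g (0 : freealg K).
Proof. by apply/homogP => m; rewrite mcoeff0 eqxx. Qed.

Lemma homogB g a b : homog g a -> homog g b -> homog g (a - b).
Proof.
move=> /homogP ag /homogP bg; apply/homogP => m.
rewrite mcoeffB; have [->|/ag //] := eqVneq (a@_m) 0.
by rewrite sub0r oppr_eq0; apply: bg.
Qed.

Lemma homogD g a b : homog g a -> homog g b -> homog g (a + b).
Proof.
move=> ag bg; rewrite -[b]opprK; apply: homogB => //.
by rewrite -sub0r; apply: homogB => //; apply: homog0.
Qed.

Lemma homogZ g (k : K) a : homog g a -> homog g (k *: a).
Proof.
move=> /homogP ag; apply/homogP => m; rewrite mcoeffZ => nz.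
by apply: ag; apply: contraNneq nz => ->; rewrite mulr0.
Qed.

Lemma homogU m : homog (alpha m) (<< m >> : freealg K).
Proof.
apply/homogP => m'; rewrite mcoeffU1.
by case: (altP (m =P m')) => [->|] //; rewrite eqxx.
Qed.

Lemma homogM g h a b : homog g a -> homog h b -> homog (g + h) (a * b).
Proof.
move=> /homogP ag /homogP bh; apply/homogP => m; rewrite mcoeff_neq0.
case/msuppM_le => m1 [m2 []]; rewrite -!mcoeff_neq0 => /ag <- /bh <- ->.
exact: alphaM.
Qed.

Lemma lie_subalgebra_lieL : lie_subalgebra (lieL K).
Proof.
split=> [S [[S0 _ _] _] //|k a b La Lb S SS|a b La Lb S SS].
  by have [[_ + _] _] := SS; apply; [apply: La|apply: Lb].
by have [[_ _ +] _] := SS; apply; [apply: La|apply: Lb].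
Qed.

Lemma lieLU (x : var) : lieL K << fmu x >>.
Proof. by move=> S [_]; apply; exists x. Qed.

(* A letter [(g, a)] records the degree of [a], which [a = 0] does not
   determine. *)
Definition hlie p : Prop := (lieL K `&` homog p.1) p.2.

Lemma hlie0 g : hlie (g, 0).
Proof.
by split; [case: lie_subalgebra_lieL | apply: homog0].
Qed.

Lemma hlieU (x : var) : hlie (x.1, << fmu x >>).
Proof. by split; [apply: lieLU | rewrite -alphaU; apply: homogU]. Qed.

Definition hbracket p q := (p.1 + q.1, bracket p.2 q.2).

Lemma hlie_bracket p q : hlie p -> hlie q -> hlie (hbracket p q).
Proof.
move=> [Lp gp] [Lq gq]; split=> /=.
  by case: lie_subalgebra_lieL => _ _; apply.
by apply: homogB; last rewrite addrC; apply: homogM.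
Qed.

(** * Words in homogeneous Lie elements *)

Definition wdeg w : 'Z_3 := \sum_(p <- w) p.1.
Definition wprod w : freealg K := \prod_(p <- w) p.2.
Definition hword g w : Prop := (forall p, p \in w -> hlie p) /\ wdeg w = g.

Lemma wprod_cat w s : wprod (w ++ s) = wprod w * wprod s.
Proof. exact: big_cat. Qed.

Lemma wdeg_cat w s : wdeg (w ++ s) = wdeg w + wdeg s.
Proof. exact: big_cat. Qed.

Lemma hword_cat g h w s : hword g w -> hword h s -> hword (g + h) (w ++ s).
Proof.
move=> [wL <-] [sL <-]; split; last exact: wdeg_cat.
by move=> p; rewrite mem_cat => /orP[/wL|/sL].
Qed.

Lemma perm_hword g w s : perm_eq w s -> hword g w -> hword g s.
Proof.
move=> e [wL <-]; split; first by move=> p; rewrite -(perm_mem e); apply: wL.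
by rewrite /wdeg (perm_big _ e).
Qed.

Lemma hword_bracket g w s p q :
  hword g (w ++ p :: q :: s) -> hword g (w ++ hbracket p q :: s).
Proof.
move=> [wL <-]; split; last by rewrite /wdeg !big_cat /= !big_cons /= !addrA.
have [pL qL] : hlie p /\ hlie q.
  by split; apply: wL; rewrite mem_cat !inE eqxx ?orbT.
move=> r; rewrite mem_cat inE => /or3P[rw|/eqP->|rs].
- by apply: wL; rewrite mem_cat rw.
- exact: hlie_bracket.
- by apply: wL; rewrite mem_cat !inE rs !orbT.
Qed.

(** * Permuting letters modulo shorter words *)

Section Reorder.
Variables (P : freealg K -> Prop) (g : 'Z_3) (n : nat).
Hypothesis PD : forall a b, P a -> P b -> P (a + b).
Hypothesis Pshorter : forall w, (size w < n)%N -> hword g w -> P (wprod w).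

(** Since $pq = [p,q] + qp$, the two products differ by that of a word with one letter fewer, the
    bracket being a single letter. *)
Lemma word_swap w s p q : hword g (w ++ p :: q :: s) ->
  size (w ++ p :: q :: s) = n ->
  P (wprod (w ++ q :: p :: s)) -> P (wprod (w ++ p :: q :: s)).
Proof.
move=> hw szw Pw.
have -> : wprod (w ++ p :: q :: s) =
    wprod (w ++ hbracket p q :: s) + wprod (w ++ q :: p :: s).
  rewrite !wprod_cat /wprod !big_cons /= /bracket -mulrDr !mulrA -mulrDl subrK.
  by rewrite !mulrA.
apply: PD => //; apply: Pshorter; last exact: hword_bracket.
by rewrite -szw !size_cat /= ltn_add2l.
Qed.

Lemma word_move w u s p : hword g (w ++ p :: u ++ s) ->
  size (w ++ p :: u ++ s) = n ->
  P (wprod (w ++ u ++ p :: s)) -> P (wprod (w ++ p :: u ++ s)).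
Proof.
elim: u w => [//|q u IHu] w hw szw Pw.
apply: word_swap => //; rewrite -cat_rcons.
apply: IHu; rewrite ?cat_rcons //.
  apply: perm_hword hw; rewrite perm_cat2l.
  exact: (permEl (perm_catCA [:: p] [:: q] _)).
by rewrite -szw !size_cat.
Qed.

(** The prefix [w] holds the letters already treated: the tail of [s] is rearranged behind its head
    [p], then [p] is moved to its place in [t]. *)
Lemma word_perm w s t : perm_eq s t -> hword g (w ++ s) ->
  size (w ++ s) = n -> P (wprod (w ++ t)) -> P (wprod (w ++ s)).
Proof.
elim: s t w => [|p s IHs] t w; first by rewrite perm_sym => /perm_nilP ->.
move=> e; have pt : p \in t by rewrite -(perm_mem e) mem_head.
case/splitPr: pt e => u v e.
have {}e : perm_eq s (u ++ v).
  rewrite -(perm_cons p); apply: (perm_trans e).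
  exact: (permEl (perm_catCA u [:: p] v)).
move=> hw szw Pt; rewrite -cat_rcons; apply: (IHs (u ++ v)) => //.
- by rewrite cat_rcons.
- by rewrite cat_rcons.
rewrite cat_rcons; apply: word_move => //.
  by apply: perm_hword hw; rewrite perm_cat2l perm_cons.
by rewrite -szw !size_cat /= (perm_size e) size_cat.
Qed.

End Reorder.

(** * Splitting off short words of degree 0 *)

Lemma zero_degree_subword w : (2 < size w)%N ->
  exists z s, [/\ perm_eq w (z ++ s), wdeg z = 0 & (0 < size z <= 3)%N].
Proof.
case: w => [|p [|q [|r t]]] // _.
(* Some block of consecutive letters among the first three has sum 0; it is brought to the front. *)
case/or4P: (Z3_zero_subsum p.1 q.1 r.1) => [/eqP e|/eqP e|/eqP e|/or3P[]/eqP e].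
- by exists [:: p], (q :: r :: t); rewrite /wdeg big_seq1.
- exists [:: q], (p :: r :: t); split=> //; last by rewrite /wdeg big_seq1.
  exact: (permEl (perm_catCA [:: p] [:: q] _)).
- exists [:: r], (p :: q :: t); split=> //; last by rewrite /wdeg big_seq1.
  exact: (permEl (perm_catCA [:: p; q] [:: r] _)).
- by exists [:: p; q], (r :: t); rewrite /wdeg !big_cons big_nil addr0.
- exists [:: q; r], (p :: t); rewrite /wdeg !big_cons big_nil addr0; split=> //.
  exact: (permEl (perm_catCA [:: p] [:: q; r] _)).
- by exists [:: p; q; r], t; rewrite /wdeg !big_cons big_nil addr0 addrA.
Qed.

(* The extension step may be proved at whichever end is convenient, since the
   letters of sum zero can be gathered at either one. *)
Lemma hword_ind (P : freealg K -> Prop) g :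
  (forall a b, P a -> P b -> P (a + b)) ->
  (forall s, hword g s -> (size s <= 3)%N -> P (wprod s)) ->
  (forall z s, hword 0 z -> (size z <= 3)%N -> hword g s -> P (wprod s) ->
     P (wprod z * wprod s) \/ P (wprod s * wprod z)) ->
  forall w, hword g w -> P (wprod w).
Proof.
move=> PD Pshort Pext w; move: {2}(size w).+1 (ltnSn (size w)) => n.
elim: n w => // n IHn w; rewrite ltnS leq_eqVlt => /orP[/eqP szw|]; last exact: IHn.
move=> hw; have [|w_long] := leqP (size w) 3; first exact: Pshort.
have [z [s [e z0 /andP[z_gt0 z_le3]]]] := zero_degree_subword (ltnW w_long).
have [zL sg] : hword 0 z /\ hword g s.
  have [L d] := perm_hword e hw; rewrite wdeg_cat z0 add0r in d.
  by split; split=> // p pz; apply: L; rewrite mem_cat pz ?orbT.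
have Ps : P (wprod s).
  by apply: IHn => //; rewrite -szw (perm_size e) size_cat -[ltnLHS]add0n ltn_add2r.
have reorder t : perm_eq w t -> P (wprod t) -> P (wprod w).
  by move=> ewt; apply: (@word_perm P g n PD IHn [::] w t).
case: (Pext z s) => // Pzs.
  by apply: (reorder (z ++ s)); rewrite ?wprod_cat.
apply: (reorder (s ++ z)); last by rewrite wprod_cat.
exact: perm_trans e (permEl (perm_catC z s)).
Qed.

Definition monoword (m : mono) := [seq (x.1, << fmu x >> : freealg K) | x <- m].

Lemma monalgUM m1 m2 : << mmul m1 m2 >> = << m1 >> * << m2 >> :> freealg K.
Proof. by rewrite malgM_def fgmulUU mulr1. Qed.

Lemma wprod_monoword m : wprod (monoword m) = << m >>.
Proof.
rewrite /wprod big_map; case: m => m /=.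
elim: m => [|x m IHm]; first by rewrite big_nil -fmoneE.
rewrite big_cons IHm -monalgUM; congr << _ >>.
by apply/eqP; rewrite fmP fmM fmU.
Qed.

Lemma hword_monoword m : hword (alpha m) (monoword m).
Proof.
by split; [move=> p /mapP[x _ ->]; apply: hlieU | rewrite /wdeg big_map].
Qed.

(** * Graded substitutions and generic words *)

Section Substitution.
Variable u : var -> freealg K.

Definition submono (m : mono) : freealg K := \prod_(x <- m) u x.

Lemma submono_mmorphism : mmorphism submono.
Proof.
by split=> [m1 m2|]; rewrite /submono ?fmM ?big_cat // fm1 big_nil.
Qed.

HB.instance Definition _ := isMultiplicative.Build mono (freealg K) submono
  submono_mmorphism.

Definition subst : freealg K -> freealg K := mmap (@malgC mono K) submono.

(** The target of [subst] is noncommutative, so its multiplicativity rests on scalars commuting with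
    the values of monomials. *)
Lemma malgC_central (k : K) a : GRing.comm k%:MP a.
Proof.
rewrite /GRing.comm !malgM_def fgmulUg fgmulgU.
by apply: eq_bigr => m _; rewrite mul1m mulm1 mulrC.
Qed.

HB.instance Definition _ := GRing.Additive.on subst.

Lemma subst_monoid : multiplicative subst.
Proof. by apply: commr_mmap_is_multiplicative => a m m'; apply: malgC_central. Qed.

HB.instance Definition _ :=
  GRing.isMultiplicative.Build (freealg K) (freealg K) subst subst_monoid.

Lemma subst_scalable : scalable subst.
Proof. by move=> k a; rewrite /subst mmapZ mul_malgC. Qed.

HB.instance Definition _ :=
  GRing.isScalable.Build K (freealg K) (freealg K) *:%R subst subst_scalable.

Lemma subst_bracket a b : subst (bracket a b) = bracket (subst a) (subst b).
Proof. by rewrite rmorphB !rmorphM. Qed.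

Lemma subst_swap13 a b c :
  subst (swap13 a b c) = swap13 (subst a) (subst b) (subst c).
Proof. by rewrite rmorphB !rmorphM. Qed.

Lemma substU m : subst << m >> = \prod_(x <- m) u x.
Proof. by rewrite /subst mmapU mul1r. Qed.

Lemma subst_var x : subst << fmu x >> = u x.
Proof. by rewrite substU fmU big_seq1. Qed.

Hypothesis u_homog : forall x, homog x.1 (u x).

Lemma graded_subst : graded_endo subst.
Proof.
move=> g _ [_ [s [c [sg ->]] <-]]; rewrite raddf_sum /=.
rewrite big_seq; apply: big_ind => [|a b|m /sg <-]; [exact: homog0|exact: homogD|].
rewrite linearZ /=; apply: homogZ; rewrite substU /alpha.
elim: (m : seq var) => [|x t IHt]; last by rewrite !big_cons; apply: homogM.
by rewrite !big_nil -alpha1; apply: homogU.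
Qed.

End Substitution.

(** The generic word of the shape of [w]: each letter becomes a variable of its degree, indexed by
    its position. Distinct positions give multilinearity, and the offset [k] keeps several words on
    disjoint variables. *)
Definition wvars (k : nat) w : mono := FMonom (zip (unzip1 w) (iota k (size w))).

(** A variable whose index lies outside [w] or meets a letter of another degree goes to 0, so the
    substitution is graded on all variables. *)
Definition wvalue w (x : var) : freealg K :=
  let p := nth (0, 0) w x.2 in if p.1 == x.1 then p.2 else 0.

(** The context [z], [s] lets one substitution evaluate several adjacent words at once. *)
Lemma subst_wvars z w s :
  subst (wvalue (z ++ w ++ s)) << wvars (size z) w >> = wprod w.
Proof.
rewrite substU /wprod /=; elim: w z => [|p w IHw] z; first by rewrite !big_nil.
rewrite /= !big_cons {1}/wvalue /= nth_cat ltnn subnn /= eqxx; congr (_ * _).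
(* The evaluated letter joins the prefix, which advances the offset by one. *)
by rewrite -cat_rcons -(size_rcons z p); apply: IHw.
Qed.

Lemma alpha_wvars k w : alpha (wvars k w) = wdeg w.
Proof.
rewrite /alpha /wdeg /=; elim: w k => [|p w IHw] k; first by rewrite !big_nil.
by rewrite /= !big_cons IHw.
Qed.

Lemma fdeg_wvars k w : fdeg (wvars k w) = size w.
Proof. by rewrite /fdeg /= size_zip size_map size_iota minnn. Qed.

Lemma wvars_cat k w s :
  mmul (wvars k w) (wvars (k + size w) s) = wvars k (w ++ s).
Proof.
apply/eqP; rewrite fmP fmM /= /unzip1 map_cat size_cat iotaD zip_cat //.
by rewrite size_map size_iota.
Qed.

Lemma multilinear_wvars k w : multilinear (wvars k w).
Proof.
apply: (@map_uniq _ _ snd); rewrite /= -/(unzip2 _) unzip2_zip ?iota_uniq //.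
by rewrite size_map size_iota.
Qed.

Lemma wvalue_hlie w x :
  (forall p, p \in w -> hlie p) -> (lieL K `&` homog x.1) (wvalue w x).
Proof.
move=> wL; rewrite /wvalue; case: eqP => [<-|_]; last exact: hlie0.
case: (ltnP x.2 (size w)) => [lt|le]; first by apply: wL; apply: mem_nth.
by rewrite nth_default //; apply: hlie0.
Qed.

Lemma weak_TG_ideal_gen_weak (S : set (freealg K)) :
  weak_TG_ideal (weak_TG_ideal_gen S).
Proof.
split=> [|phi gphi Lphi _ [f If <-] J wJ].
  split=> [J|a b Ia Ib J wJ|a b f If J wJ]; first by case=> [[[]]].
    by have [[[_ JB _] _] _] := wJ; apply: JB; [apply: Ia|apply: Ib].
  by have [[[_ _ JM] _] _] := wJ; apply: JM; apply: If.
by have [[_ Jphi] _] := wJ; apply: (Jphi phi) => //; exists f => //; apply: If.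
Qed.

(** * Consequences of the reduced identities in a weak ideal *)

Section Identities.
Variable I : set (freealg K).
Hypothesis weakI : weak_TG_ideal I.

Lemma idealB a b : I a -> I b -> I (a - b).
Proof. by case: weakI => [[_ + _] _]; apply. Qed.

Lemma ideal_opp a : I a -> I (- a).
Proof. by rewrite -sub0r; apply: idealB; case: weakI => [[]]. Qed.

Lemma idealD a b : I a -> I b -> I (a + b).
Proof. by move=> Ia Ib; rewrite -[b]opprK; apply: idealB => //; apply: ideal_opp. Qed.

Lemma idealMl a b : I b -> I (a * b).
Proof. by case: weakI => [[_ _ +] _] => IM /(IM a 1); rewrite mulr1. Qed.

Lemma idealMr a b : I a -> I (a * b).
Proof. by case: weakI => [[_ _ +] _] => IM /(IM 1 b); rewrite mul1r. Qed.

Lemma ideal_subst w a :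
  (forall p, p \in w -> hlie p) -> I a -> I (subst (wvalue w) a).
Proof.
move=> wL Ia; case: weakI => _ Iphi.
have valL x := wvalue_hlie x wL.
apply: (Iphi (subst (wvalue w))); last by exists a.
  by apply: graded_subst => x; case: (valL x).
by move=> x; rewrite /= subst_var; apply: valL.
Qed.

Hypothesis I1 : reduced_type1 K `<=` I.
Hypothesis I2 : reduced_type2 K `<=` I.

(** Evaluates a reduced type 1 identity in generic words by substituting the letters of [s ++ t]. *)
Lemma short_commute s t : hword 0 s -> hword 0 t ->
  (size s <= 3)%N -> (size t <= 3)%N -> I (bracket (wprod s) (wprod t)).
Proof.
move=> hs ht s3 t3; have [wL _] := hword_cat hs ht.
have {1}<- : subst (wvalue (s ++ t)) << wvars 0 s >> = wprod s.
  exact: (@subst_wvars [::]).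
have <- : subst (wvalue (s ++ t)) << wvars (size s) t >> = wprod t.
  by rewrite -{1}[t]cats0; apply: subst_wvars.
rewrite -subst_bracket; apply: ideal_subst => //.
apply: I1; exists (wvars 0 s), (wvars (size s) t); split; rewrite ?fdeg_wvars //.
case: hs ht => _ ds [_ dt]; split; rewrite ?alpha_wvars //.
by rewrite -[size s]add0n wvars_cat; apply: multilinear_wvars.
Qed.

(** As $[\cdot, c]$ is a derivation, commuting with [c] passes to products and sums. First [s] is
    lengthened against a short [t], then [t] against an arbitrary [s]. *)
Lemma words_commute : forall s t,
  hword 0 s -> hword 0 t -> I (bracket (wprod s) (wprod t)).
Proof.
have sym a b : I (bracket a b) -> I (bracket b a).
  by move=> /ideal_opp; rewrite /bracket opprB.
have ext c a b : I (bracket a c) -> I (bracket b c) -> I (bracket (a * b) c).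
  move=> Ia Ib; have -> : bracket (a * b) c = a * bracket b c + bracket a c * b.
    by rewrite /bracket mulrBr mulrBl !mulrA addrA subrK.
  by apply: idealD; [apply: idealMl|apply: idealMr].
have add c a b : I (bracket a c) -> I (bracket b c) -> I (bracket (a + b) c).
  move=> Ia Ib; have -> : bracket (a + b) c = bracket a c + bracket b c.
    by rewrite /bracket mulrDr mulrDl opprD addrACA.
  exact: idealD.
have short_r s t : hword 0 s -> hword 0 t -> (size t <= 3)%N ->
    I (bracket (wprod s) (wprod t)).
  move=> hs ht t3.
  apply: (hword_ind (P := fun a => I (bracket a (wprod t)))) hs.
  - exact: add.
  - by move=> s' hs' s3; apply: short_commute.
  - move=> z s' hz z3 _ Is'; left.
    exact: ext (short_commute hz ht z3 t3) Is'.
move=> s t hs ht; apply: (sym).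
apply: (hword_ind (P := fun a => I (bracket a (wprod s)))) ht.
- exact: add.
- by move=> t' ht' t3; apply: sym; apply: short_r.
- move=> z t' hz z3 _ It'; left.
  exact: ext (sym _ _ (short_r s z hs hz z3)) It'.
Qed.

Lemma swap13_sym a b c : I (swap13 a b c) -> I (swap13 c b a).
Proof. by move=> /ideal_opp; rewrite /swap13 opprB. Qed.

Lemma short_swap13 g s t r : hword g s -> hword (- g) t -> hword g r ->
  (size s <= 3)%N -> (size t <= 3)%N -> (size r <= 3)%N ->
  I (swap13 (wprod s) (wprod t) (wprod r)).
Proof.
move=> hs ht hr s3 t3 r3; have [wL _] := hword_cat hs (hword_cat ht hr).
set phi := subst (wvalue (s ++ t ++ r)).
have sE : phi << wvars 0 s >> = wprod s by exact: (@subst_wvars [::]).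
have tE : phi << wvars (size s) t >> = wprod t by exact: subst_wvars.
have rE : phi << wvars (size (s ++ t)) r >> = wprod r.
  by rewrite /phi catA -{1}[r]cats0; apply: subst_wvars.
rewrite -sE -tE -rE -subst_swap13; apply: ideal_subst => //.
apply: I2.
exists (wvars 0 s), (wvars (size s) t), (wvars (size (s ++ t)) r).
split; rewrite ?fdeg_wvars //.
case: hs ht hr => _ ds [_ dt] [_ dr]; split; rewrite ?alpha_wvars ?ds ?dt ?dr //.
  by rewrite opprK.
rewrite -[size s]add0n wvars_cat -[size (s ++ t)]add0n wvars_cat.
exact: multilinear_wvars.
Qed.

(** By [swap13Ml], prefixing a degree 0 word [z] to [s] adds only a multiple of the commutator of
    [z] with the product of [r ++ t], a word of degree $g - g = 0$. *)
Lemma swap13_extend g t r : hword (- g) t -> hword g r ->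
  (forall s, hword g s -> (size s <= 3)%N ->
     I (swap13 (wprod s) (wprod t) (wprod r))) ->
  forall s, hword g s -> I (swap13 (wprod s) (wprod t) (wprod r)).
Proof.
move=> ht hr short s hs.
apply: (hword_ind (P := fun a => I (swap13 a (wprod t) (wprod r)))) hs; last 1 first.
- move=> z s' hz _ _ Is'; left.
  rewrite swap13Ml -wprod_cat; apply: idealD; first exact: idealMl.
  apply: idealMr; apply: words_commute => //.
  by have := hword_cat hr ht; rewrite subrr.
- by move=> a b Ia Ib; rewrite swap13Dl; apply: idealD.
- exact: short.
Qed.

Lemma words_swap13 g s t r : hword g s -> hword (- g) t -> hword g r ->
  I (swap13 (wprod s) (wprod t) (wprod r)).
Proof.
(* The outer words are lengthened one after the other, the symmetry exchanging them, while the
   middle one stays short. *)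
have short_t s' t' r' : hword g s' -> hword (- g) t' -> hword g r' ->
    (size t' <= 3)%N -> I (swap13 (wprod s') (wprod t') (wprod r')).
  move=> hs ht hr t3; apply: (swap13_extend ht hr) hs => u hu u3.
  apply: swap13_sym; apply: (swap13_extend ht hu) hr => v hv v3.
  exact: (short_swap13 hv ht hu).
move=> hs ht hr.
apply: (hword_ind (P := fun b => I (swap13 (wprod s) b (wprod r)))) ht.
- by move=> a b Ia Ib; rewrite swap13Dm; apply: idealD.
- by move=> t' ht' t3; apply: short_t.
(* The middle word grows at its right end, as [swap13Mm] requires; the errors are commutators of [z]
   with the degree 0 words [s ++ t'] and [r ++ t']. *)
- move=> z t' hz _ ht' It'; right.
  have h0 h : hword g h -> I (bracket (wprod h * wprod t') (wprod z)).
    move=> hh; rewrite -wprod_cat; apply: words_commute => //.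
    by have := hword_cat hh ht'; rewrite subrr.
  rewrite swap13Mm; apply: idealB; last by apply: idealMr; apply: h0.
  by apply: idealD; [apply: idealMr; apply: h0|apply: idealMl].
Qed.

(** Variables are homogeneous Lie elements, so monomials are words and the results on words apply to
    them. *)
Lemma type1_type2_sub : type1 K `|` type2 K `<=` I.
Proof.
move=> _ [[h1 [h2 [[a1 a2 _] ->]]]|[h1 [h2 [h3 [[a13 a32 _] ->]]]]].
  have := hword_monoword h1; have := hword_monoword h2; rewrite a1 a2 => w2 w1.
  by rewrite -!wprod_monoword; apply: words_commute.
have := hword_monoword h1; have := hword_monoword h2; have := hword_monoword h3.
rewrite a13 -[alpha h2]opprK -a32 => w3 w2 w1.
by rewrite /type2_poly -!wprod_monoword; apply: (words_swap13 w1 w2 w3).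
Qed.

End Identities.
End GradedWords.

Theorem corollary7p22 (K : idomainType) (K_infinite : infinite_set [set: K]) :
  weak_TG_ideal_gen (type1 K `|` type2 K) =
  weak_TG_ideal_gen (reduced_type1 K `|` reduced_type2 K).
Proof.
rewrite eqEsubset; split.
  apply: smallest_sub; first exact: weak_TG_ideal_gen_weak.
  by apply: type1_type2_sub; first exact: weak_TG_ideal_gen_weak;
    move=> f rf J [_]; apply; [left|right].
apply: smallest_sub; first exact: weak_TG_ideal_gen_weak.
move=> f rf J [_]; apply; case: rf => [[h1 [h2 [c _ _ ->]]]|].
  by left; exists h1, h2.
by case=> h1 [h2 [h3 [c _ ->]]]; right; exists h1, h2, h3.
Qed.
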